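(* Let $G=K\rtimes H$ be a finite Frobenius group with Frobenius kernel $K$ and Frobenius complement $H$. Then $\omega(G)=\omega(K)\cup\omega(H)$ and $\eta(G)=\eta(K)+\eta(H)-1$.
   Context: For a finite group $G$, $\omega(G)$ denotes the set of orders of elements of $G$ and $\eta(G)=|\omega(G)|$. *)

(* Defs.v *)
From mathcomp Require Import all_boot all_fingroup all_solvable finmap.

Set Implicit Arguments.
Unset Strict Implicit.
Unset Printing Implicit Defensive.

Local Open Scope group_scope.
Local Open Scope fset_scope.

Definition omega (gT : finGroupType) (G : {group gT}) : {fset nat} :=
  [fset #[x] | x in G].

Definition eta (gT : finGroupType) (G : {group gT}) : nat := #|` omega G|.

(* Main.v *)
Require Import Defs.
From mathcomp Require Import all_boot all_fingroup all_solvable finmap.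

(** The kernel [K] and the [K]-conjugates of [H^#] partition [G]
    ([Frobenius_partition]).  Conjugation preserves orders, so every element
    order of [G] already occurs in [K] or in [H].  Moreover #|K| and #|H| are
    coprime ([Frobenius_coprime]), because [H] acts semiregularly on [K^#]; by
    Lagrange an order occurring in both groups divides two coprime numbers, so
    it is 1.  Hence the two sets of orders share exactly one element, and
    inclusion-exclusion gives the count. *)

Lemma mem_omega (gT : finGroupType) (G : {group gT}) (n : nat) :
  reflect (exists2 x, x \in G & #[x]%g = n) (n \in omega G).
Proof.
apply: (iffP (imfsetP _ _ _ _)) => [] [x Gx nE]; by exists x.
Qed.

Lemma omegaS (gT : finGroupType) (A B : {group gT}) :
  A \subset B -> (omega A `<=` omega B)%fset.
Proof.
move=> /subsetP sAB; apply/fsubsetP => n /mem_omega [x Ax <-].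
by apply/mem_omega; exists x; rewrite ?sAB.
Qed.

(** By Lagrange, a common element order divides both group orders, hence their
    gcd; the identity shows that 1 is always common. *)
Lemma omegaI_coprime (gT : finGroupType) (A B : {group gT}) :
  coprime #|A| #|B| -> (omega A `&` omega B = [fset 1%N])%fset.
Proof.
move=> coAB; apply/fsetP => n; rewrite in_fsetI in_fset1.
apply/andP/eqP => [[/mem_omega [x Ax xE] /mem_omega [y By yE]] | ->].
- apply/eqP; rewrite -dvdn1 -(eqP coAB) dvdn_gcd -{1}xE -yE.
  by rewrite !order_dvdG.
- by split; apply/mem_omega; exists 1%g; rewrite ?group1 ?order1.
Qed.

(** Each element of [G] lies in [K] or in a conjugate of [H], and conjugating
    an element does not change its order. *)
Lemma Frobenius_omega (gT : finGroupType) (G K H : {group gT}) :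
  [Frobenius G = K ><| H]%g -> omega G = (omega K `|` omega H)%fset.
Proof.
move=> frobG; have [/sdprodW/mulG_sub[sKG sHG] _ _ _ _] := Frobenius_context frobG.
apply/eqP; rewrite eqEfsubset fsubUset !omegaS // !andbT.
apply/fsubsetP => n /mem_omega [x Gx <-]; rewrite in_fsetU.
have /and3P[/eqP covG _ _] := Frobenius_partition frobG.
move: Gx; rewrite -{1}covG => /bigcupP[X /setU1P[-> Kx | /imsetP[k _ ->]]].
- by apply/orP; left; apply/mem_omega; exists x.
- case/imsetP=> h /setD1P[_ Hh] ->; rewrite orderJ.
  by apply/orP; right; apply/mem_omega; exists h.
Qed.

Theorem proposition3p4 (gT : finGroupType) (G K H : {group gT})
    (frobG : [Frobenius G = K ><| H]%g) :
  omega G = (omega K `|` omega H)%fset /\ eta G = (eta K + eta H - 1)%N.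
Proof.
have omegaG := Frobenius_omega _ _ _ _ frobG; split=> //.
rewrite /eta omegaG cardfsU omegaI_coprime ?cardfs1 //.
exact: Frobenius_coprime frobG.
Qed.
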